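(* Let $T>0$ and let $\alpha,\gamma\in(0,1]$ with $\alpha+\gamma>1$. Let $X=(X_t)_{t\in[0,T]}$ and $Y=(Y_t)_{t\in[0,T]}$ be stochastic processes on the same probability space with $X\in BV_iC^{\alpha}$ and $Y\in C^{\gamma}([0,T])$. Then the integral $$\int_0^T Y_u\,\mathrm{d}X_u$$ exists almost surely as a limit of Riemann--Stieltjes sums. Moreover, the following change of variable formula holds almost surely: $$\int_0^T X_u\,\mathrm{d}Y_u=Y_TX_T-Y_0X_0-\int_0^T Y_u\,\mathrm{d}X_u.$$
   Context: $C^{\alpha}([0,T])$ is the space of Hölder continuous functions of order $\alpha$ on $[0,T]$; for a stochastic process $X$, $X\in C^\alpha([0,T])$ means that its sample paths belong to this space almost surely. $BV^{loc}$ is the space of functions $g:\mathbb{R}\to\mathbb{R}$ that are of bounded variation (bounded $1$-variation) over every compact subset of $\mathbb{R}$. Assumption (D) on a real-valued process $X=(X_t)_{t\in[0,T]}$: for almost every $t\in[0,T]$ the random variable $X_t$ has a density $p_t(y)$ (with respect to Lebesgue measure), and there exists $g\in L^1([0,T])$ such that $\sup_y p_t(y)\le g(t)$ for almost every $t\in[0,T]$. A process $Z$ belongs to $BV_iC^{\alpha}$ if it can be written as $Z_t=g(X_t)$, $t\in[0,T]$, for some (deterministic) $g\in BV^{loc}$ and some process $X\in C^\alpha([0,T])$ satisfying Assumption (D). Existence of $\int_0^T U_u\,\mathrm{d}V_u$ as a limit of Riemann--Stieltjes sums means: for any sequence of partitions $\pi_n=\{0=t_0^n<\cdots<t_{k(n)}^n=T\}$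 with $|\pi_n|=\max_j|t_j^n-t_{j-1}^n|\to0$ and points $t_i\in[t_{i-1}^n,t_i^n]$, the sums $\sum_{i=1}^{k(n)}U_{t_i}(V_{t_i^n}-V_{t_{i-1}^n})$ converge almost surely, to a limit not depending on these choices, which is the integral. Under the hypotheses of the claim, $\int_0^T X_u\,\mathrm{d}Y_u$ exists almost surely as a limit of Riemann--Stieltjes sums in this sense. *)

(* Defs.v *)
From HB Require Import structures.
From mathcomp Require Import all_boot all_order all_algebra.
From mathcomp Require Import all_classical all_reals all_analysis.

Set Implicit Arguments.
Unset Strict Implicit.
Unset Printing Implicit Defensive.

Import Order.TTheory GRing.Theory Num.Theory.
Import numFieldNormedType.Exports.

Local Open Scope classical_set_scope.
Local Open Scope ring_scope.

Definition holder_on (R : realType) (T alpha : R) (f : R -> R) : Prop :=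
  exists C : R, forall s t : R, s \in `[0, T] -> t \in `[0, T] ->
    `|f s - f t| <= C * `|s - t| `^ alpha.

(* A process on [0, T] is a family indexed by all of R of which only the
   members with index in [0, T] are ever used. *)
Definition holder_process (d : measure_display) (Omega : measurableType d)
    (R : realType) (P : probability Omega R) (T alpha : R)
    (X : R -> {RV P >-> R}) : Prop :=
  {ae P, forall w, holder_on T alpha (fun t => X t w)}.

Definition BV_loc (R : realType) (g : R -> R) : Prop :=
  forall a b : R, a <= b -> bounded_variation a b g.

Definition is_density (d : measure_display) (Omega : measurableType d)
    (R : realType) (P : probability Omega R) (X : {RV P >-> R})
    (p : R -> R) : Prop :=
  [/\ measurable_fun setT p, forall y, 0 <= p y &
      forall A : set R, measurable A ->
        distribution P X A = (\int[lebesgue_measure]_(y in A) (p y)%:E)%E].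

Definition assumption_D (d : measure_display) (Omega : measurableType d)
    (R : realType) (P : probability Omega R) (T : R)
    (X : R -> {RV P >-> R}) : Prop :=
  exists (p : R -> R -> R) (g : R -> R),
    [/\ {ae lebesgue_measure, forall t : R, t \in `[0, T] ->
           is_density (X t) (p t)},
        lebesgue_measure.-integrable `[0, T] (EFin \o g) &
        {ae lebesgue_measure, forall t : R, t \in `[0, T] ->
           forall y, p t y <= g t}].

Definition BViC (d : measure_display) (Omega : measurableType d)
    (R : realType) (P : probability Omega R) (T alpha : R)
    (Z : R -> {RV P >-> R}) : Prop :=
  exists (g : R -> R) (X : R -> {RV P >-> R}),
    [/\ BV_loc g, holder_process T alpha X, assumption_D T X &
        forall (t : R) (w : Omega), t \in `[0, T] -> Z t w = g (X t w)].

(* As in [itv_partition], the partition 0 = t_0 < t_1 < ... < t_k = T is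
   encoded by the sequence s = [:: t_1; ...; t_k]; [pt s i] is t_i. *)
Definition pt (R : realType) (s : seq R) (i : nat) : R := nth 0 (0 :: s) i.

Definition mesh (R : realType) (s : seq R) : R :=
  \big[Num.max/0]_(0 <= i < size s) `|pt s i.+1 - pt s i|.

Definition tags (R : realType) (s : seq R) (tau : nat -> R) : Prop :=
  forall i, (i < size s)%N -> pt s i <= tau i <= pt s i.+1.

Definition RS_sum (R : realType) (U V : R -> R) (s : seq R) (tau : nat -> R)
    : R :=
  \sum_(0 <= i < size s) U (tau i) * (V (pt s i.+1) - V (pt s i)).

(* The integral is one random variable I that serves all sequences of tagged
   partitions; the exceptional null set may depend on the sequence. *)
Definition is_RS_integral (d : measure_display) (Omega : measurableType d)
    (R : realType) (P : probability Omega R) (T : R)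
    (U V : R -> {RV P >-> R}) (I : {RV P >-> R}) : Prop :=
  forall (s : nat -> seq R) (tau : nat -> nat -> R),
    (forall n, itv_partition 0 T (s n)) ->
    (forall n, tags (s n) (tau n)) ->
    mesh (s n) @[n --> \oo] --> (0 : R) ->
    {ae P, forall w,
      RS_sum (fun t => U t w) (fun t => V t w) (s n) (tau n) @[n --> \oo]
        --> I w}.

(* Main.v *)
Require Import Defs.
From HB Require Import structures.
From mathcomp Require Import all_boot all_order all_algebra.
From mathcomp Require Import all_classical all_reals all_analysis.
From mathcomp Require Import measurable_realfun ring lra.

Set Implicit Arguments.
Unset Strict Implicit.

Import Order.TTheory GRing.Theory Num.Theory.
Import numFieldNormedType.Exports.

Local Open Scope classical_set_scope.
Local Open Scope ring_scope.

(** Write [X = f(Z)] with [f] locally of bounded variation and [Z] Hoelder of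
order [alpha] with densities.  The paths of [X] have jumps wherever [Z] crosses
a jump of [f], possibly infinitely often, so Young's theorem does not apply to
them.  What survives is an averaged regularity.  Cut [0, T] into [2 ^ n] dyadic
cells.  On a cell, [Z] stays within about [2 ^ (- n alpha)] of its value at any
chosen time of the cell, so the oscillation of [X] there is at most the mass
that the variation of [f] gives to a ball of that radius around that value.
Where [Z] has a density bounded by [b(t)], the expectation of this mass is at
most a constant times [b(t) 2 ^ (- n alpha)].  Choosing in every cell a time at
which [b] does not exceed its mean by more than a constant, and summing over
the cells, the expected total oscillation at level [n] is of order
[2 ^ (n (1 - alpha))].  (The radii used below are [2 ^ (- n beta)] with
[1 - gamma < beta < alpha], which absorbs the random Hoelder constant, and the
variation of [f] is cut off outside [[- M, M]], for every integer [M].)  As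
[alpha + gamma > 1], the series
[\sum_n 2 ^ (- n gamma) (total oscillation of X at level n)] has finite
expectation, hence converges almost surely ([ae_path_osc]).

From the convergence of this series on, the argument is deterministic. If [y] is
Hoelder of order [gamma], passing from level [n] to level [n.+1] changes the
dyadic Riemann sum of [x dy] by at most a constant times [2 ^ (- n gamma)] times
the total oscillation of [x] at level [n], so the dyadic sums converge. An
arbitrary tagged partition of mesh at most [T / 2 ^ N] is compared with the
dyadic sums interval by interval ([local_estimate]): on an interval, [x] is
replaced by its difference with its value at the tag, and the same telescoping
over the levels is started at the first level, from [N] on, at which a dyadic
point falls into the interval. That point is the only one of its level in the
interval and lies in no other interval of the partition, so the errors of all
intervals together are at most a constant times the tail from level [N] of the
series above ([riemann_sums_cvg]). The bound is uniform in the partition, so the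
exceptional event depends neither on the partitions nor on the tags.

This gives the integral of [X] against [Y].  A Riemann sum of [Y dX] becomes,
by summation by parts, the boundary term minus a Riemann sum of [X dY] in which
the tags have become division points and the division points tags; its mesh at
most doubles ([RS_path_parts]).  Hence the second integral and the formula. *)

(** * Finite sums and dyadic points *)

(** Indicators, and increments over overlapping intervals, are summed below by
    bounding each of them by the increment of a monotone quantity. *)
Lemma telescope_le (R : realDomainType) (u v : nat -> R) N :
  (forall k, (k < N)%N -> u k <= v k.+1 - v k) ->
  \sum_(0 <= k < N) u k <= v N - v 0%N.
Proof.
by move=> uv; rewrite -telescope_sumr// big_nat_cond [leRHS]big_nat_cond
  ler_sum// => k /andP[/andP[_ kN] _]; exact: uv.
Qed.

Lemma sum_nat_double (V : nmodType) (h : nat -> V) N :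
  \sum_(0 <= k < N.*2) h k = \sum_(0 <= k < N) (h k.*2 + h k.*2.+1).
Proof.
elim: N => [|N IH]; first by rewrite !big_geq.
by rewrite doubleS !big_nat_recr//= IH addrA.
Qed.

Lemma ler_sum_nat_in (R : numDomainType) (u v : nat -> R) m n :
  (forall k, (m <= k < n)%N -> u k <= v k) ->
  \sum_(m <= k < n) u k <= \sum_(m <= k < n) v k.
Proof.
by move=> uv; rewrite big_nat_cond [leRHS]big_nat_cond ler_sum// => k
  /andP[]; move/uv.
Qed.

Lemma sum_geometric_le (R : realFieldType) (c : R) d :
  0 < c -> c < 1 -> \sum_(0 <= i < d) c ^+ i <= (1 - c)^-1.
Proof.
move=> c0 c1; have c1' : 0 < 1 - c by rewrite subr_gt0.
rewrite -(ler_pM2r c1') mulVf ?gt_eqF//.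
have -> : (\sum_(0 <= i < d) c ^+ i) * (1 - c) = 1 - c ^+ d.
  elim: d => [|d IH]; first by rewrite big_geq// expr0 subrr mul0r.
  by rewrite big_nat_recr//= mulrDl IH exprSr; ring.
by rewrite gerBl exprn_ge0// ltW.
Qed.

Section dyadic_grid.
Context {R : realType}.
Variable T : R.

Definition grid n k : R := T * k%:R / 2 ^+ n.

Lemma grid0 n : grid n 0 = 0.
Proof. by rewrite /grid mulr0 mul0r. Qed.

Lemma grid_end n : grid n (2 ^ n) = T.
Proof. by rewrite /grid natrX mulfK// expf_neq0// pnatr_eq0. Qed.

Lemma grid_double n k : grid n.+1 k.*2 = grid n k.
Proof.
rewrite /grid -muln2 natrM exprS.
have : (2 ^+ n : R) != 0 by rewrite expf_neq0.
by move=> ?; field.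
Qed.

Lemma gridS n k : grid n k.+1 = grid n k + T / 2 ^+ n.
Proof. by rewrite /grid -natr1 mulrDr mulr1 mulrDl. Qed.

Hypothesis T0 : 0 < T.

Lemma mesh_gt0 n : 0 < T / 2 ^+ n.
Proof. by rewrite divr_gt0// exprn_gt0. Qed.

Lemma ltr_grid n j k : (grid n j < grid n k) = (j < k)%N.
Proof.
by rewrite /grid ltr_pM2r ?invr_gt0 ?exprn_gt0// ltr_pM2l// ltr_nat.
Qed.

Lemma ler_grid n j k : (grid n j <= grid n k) = (j <= k)%N.
Proof. by rewrite leNgt ltr_grid -leqNgt. Qed.

Lemma grid_in n k : (k <= 2 ^ n)%N -> 0 <= grid n k <= T.
Proof.
move=> kn; rewrite -{1}(grid0 n) -[X in _ <= _ <= X](grid_end n).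
by rewrite !ler_grid kn.
Qed.

Lemma grid_mid_in n k : grid n k <= grid n.+1 k.*2.+1 <= grid n k.+1.
Proof. by rewrite -!(grid_double n) !ler_grid doubleS !leqnSn. Qed.

(** The intervals between consecutive grid points are disjoint: each indicator
    is the increment of the monotone indicator of [a <= grid n k]. *)
Lemma crossing_le1 n (a : R) (N : nat) :
  \sum_(0 <= k < N) (grid n k < a <= grid n k.+1)%R%:R <= 1 :> R.
Proof.
apply: le_trans (_ : (a <= grid n N)%R%:R - (a <= grid n 0)%R%:R <= _).
  apply: (@telescope_le _ _ (fun k => (a <= grid n k)%R%:R)) => k _.
  case: ltP => ka /=; case: (leP a) => //=;
    rewrite ?subrr ?subr0// ?sub0r// => k1a.
  by have := lt_le_trans k1a ka; rewrite ltr_grid ltnNge leqnSn.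
by case: (a <= grid n N); case: (a <= grid n 0);
  rewrite ?subrr ?subr0 ?sub0r// ?lerN10 ?ler01//; lra.
Qed.

End dyadic_grid.

(** * Dyadic Riemann sums *)

Section dyadic_sums.
Context {R : realType}.
Variables (T : R) (y : R -> R) (H c : R).
Hypothesis T0 : 0 < T.
(* Hoelder continuity of order [gamma], read at the dyadic scales: [c] is
   [2 ^ (- gamma)]. *)
Hypothesis yH : forall n s t, 0 <= s <= T -> 0 <= t <= T ->
  `|s - t| <= T / 2 ^+ n -> `|y s - y t| <= H * c ^+ n.

Local Notation g := (grid T).

Definition dyadic_sum (F : R -> R) n : R :=
  \sum_(0 <= k < 2 ^ n) F (g n k) * (y (g n k.+1) - y (g n k)).

Definition cut (a b : R) (F : R -> R) (t : R) : R :=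
  if a <= t < b then F t else 0.

(** Halving a cell only moves the tag of its right half from the left end of
    the cell to its midpoint. *)
Lemma dyadic_sum_step F n :
  `|dyadic_sum F n.+1 - dyadic_sum F n| <=
  H * c ^+ n.+1 *
    \sum_(0 <= k < 2 ^ n) `|F (g n.+1 k.*2.+1) - F (g n k)|.
Proof.
rewrite /dyadic_sum expnS mul2n sum_nat_double -sumrB.
rewrite (eq_bigr (fun k => (F (g n.+1 k.*2.+1) - F (g n k)) *
    (y (g n k.+1) - y (g n.+1 k.*2.+1)))); last first.
  by move=> k _; rewrite -doubleS !grid_double; ring.
apply: (le_trans (ler_norm_sum _ _ _)).
rewrite mulr_sumr; apply: ler_sum_nat_in => k /andP[_ kn].
rewrite normrM mulrC ler_wpM2r//.
have kn1 : (k.+1.*2 <= 2 ^ n.+1)%N by rewrite expnS mul2n leq_double.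
apply: yH.
- by rewrite -(grid_double T n) grid_in.
- by apply: grid_in => //; apply: leq_trans kn1; rewrite doubleS.
- rewrite -(grid_double T n) doubleS gridS addrC addKr ger0_norm//.
  by rewrite ltW// mesh_gt0.
Qed.

(** Inside a cell, a function set to zero off [[a, b)] varies as the function
    itself, unless [a] or [b] falls into the cell.  This happens to at most two
    cells, where the uniform bound [om] is used. *)
Lemma cut_osc_le a b F (om : R) n (o : nat -> R) :
  (forall t, a <= t < b -> `|F t| <= om) ->
  0 <= om ->
  (forall k, (k < 2 ^ n)%N -> 0 <= o k) ->
  (forall k s t, (k < 2 ^ n)%N -> a <= s < b -> a <= t < b ->
     g n k <= s <= g n k.+1 -> g n k <= t <= g n k.+1 ->
     `|F s - F t| <= o k) ->
  \sum_(0 <= k < 2 ^ n) `|cut a b F (g n.+1 k.*2.+1) - cut a b F (g n k)| <=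
  \sum_(0 <= k < 2 ^ n | (a <= g n k < b)%R) o k + om * 2.
Proof.
move=> Fom om0 o0 Fo.
pose cr (x : R) := \sum_(0 <= k < 2 ^ n) (g n k < x <= g n k.+1)%R%:R : R.
have crle x : cr x <= 1 by exact: crossing_le1.
apply: (@le_trans _ _ (\sum_(0 <= k < 2 ^ n | (a <= g n k < b)%R) o k
   + om * (cr a + cr b))); last first.
  by rewrite lerD2l ler_wpM2l// (_ : 2 = 1 + 1)// lerD.
have -> : cr a + cr b = \sum_(0 <= k < 2 ^ n)
    ((g n k < a <= g n k.+1)%R%:R + (g n k < b <= g n k.+1)%R%:R).
  by rewrite big_split.
apply: (@le_trans _ _ (\sum_(0 <= k < 2 ^ n)
   ((if a <= g n k < b then o k else 0) +
    om * ((g n k < a <= g n k.+1)%R%:R + (g n k < b <= g n k.+1)%R%:R))));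
  last by rewrite big_split/= -big_mkcond/= mulr_sumr.
apply: ler_sum_nat_in => k /andP[_ kn].
have /andP[gm mg] := grid_mid_in T0 n k.
have okk := o0 _ kn.
have ind0 (p : bool) : 0 <= om * p%:R by rewrite mulr_ge0.
rewrite mulrDr /cut; case: ifP => Hm; case: ifP => Hg.
- apply: (le_trans (Fo k _ _ kn Hm Hg _ _)).
  + by rewrite gm mg.
  + by rewrite lexx (le_trans gm mg).
  + by rewrite lerDl addr_ge0.
- have -> : (g n k < a <= g n k.+1) = true.
    move: Hm Hg => /andP[am mb] /negbT; rewrite negb_and -ltNge -leNgt.
    case/orP => [->/=|bg]; first exact: le_trans mg.
    by have := lt_le_trans mb (le_trans bg gm); rewrite ltxx.
  by rewrite subr0 add0r mulr1 (le_trans (Fom _ Hm))// lerDl.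
- have -> : (g n k < b <= g n k.+1) = true.
    move: Hg Hm => /andP[ag gb] /negbT; rewrite gb negb_and -ltNge -leNgt.
    case/orP => [ma|bm]; last exact: le_trans bm mg.
    by have := lt_le_trans ma (le_trans ag gm); rewrite ltxx.
  by rewrite sub0r normrN mulr1 (le_trans (Fom _ Hg))// addrA lerDr addr_ge0.
- by rewrite subrr normr0 add0r addr_ge0.
Qed.

End dyadic_sums.

Section first_grid_point.
Context {R : realType}.
Variable T : R.
Hypothesis T0 : 0 < T.
Local Notation g := (grid T).

(** A grid point of level [n > N] in an interval without points of level [n.-1]
    is the midpoint of a cell of level [n.-1] that contains the interval.  At
    level [N] itself the interval is no longer than a cell.  In both cases the
    interval lies between the two neighbours of that point. *)
Lemma first_grid_point (a b : R) N m j :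
  0 <= a -> b <= T -> b - a <= T / 2 ^+ N -> (N <= m)%N ->
  (j < 2 ^ m)%N -> a <= g m j < b ->
  exists n k, [/\ (N <= n <= m)%N, (k < 2 ^ n)%N, a <= g n k < b,
    forall i, (i < 2 ^ n)%N -> a <= g n i < b -> i = k &
    ((0 < k)%N -> g n k.-1 <= a) /\ b <= g n k.+1].
Proof.
move=> a0 bT ba Nm jm gj.
pose Q n := (N <= n)%N && [exists k : 'I_(2 ^ n), (a <= g n k < b)%R].
have Qm : exists n, Q n.
  by exists m; rewrite /Q Nm; apply/existsP; exists (Ordinal jm).
case: (ex_minnP Qm) => n /andP[Nn /existsP[[k klt]/= /andP[agk gkb]]] nmin.
have nm : (n <= m)%N.
  by apply: nmin; rewrite /Q Nm; apply/existsP; exists (Ordinal jm).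
have key : ((0 < k)%N -> g n k.-1 < a) /\ b <= g n k.+1.
  move: Nn; rewrite leq_eqVlt => /orP[/eqP Nn|Nn].
    rewrite Nn in ba; split; last by rewrite gridS; lra.
    move=> k0; have := gridS T n k.-1; rewrite prednK// => e.
    by rewrite e in agk gkb; lra.
  case: n => [//|n] in klt agk gkb nmin Nn nm *.
  have noQ i : (i <= 2 ^ n)%N -> ~~ (a <= g n i < b).
    rewrite leq_eqVlt => /orP[/eqP ->|ilt].
      by rewrite grid_end negb_and -!real_leNgt ?num_real// bT orbT.
    apply/negP => gi.
    have : (n.+1 <= n)%N.
      by apply: nmin; rewrite /Q -ltnS Nn; apply/existsP; exists (Ordinal ilt).
    by rewrite ltnn.
  have kE := odd_double_half k.
  have khalf : (k./2 < 2 ^ n)%N.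
    move: klt; rewrite -{1}kE expnS mul2n => kk.
    by rewrite -ltn_double; apply: leq_ltn_trans kk; exact: leq_addl.
  case: (odd k) kE; rewrite ?add0n ?add1n => kE; last first.
    by have := noQ _ (ltnW khalf); rewrite -(grid_double T) kE agk gkb.
  split.
    move=> _; rewrite -kE /= (grid_double T).
    have := noQ _ (ltnW khalf); rewrite negb_and -ltNge => /orP[//|].
    rewrite -leNgt => /(lt_le_trans gkb).
    by rewrite -(grid_double T n) ltr_grid// -{1}kE ltnNge leqnSn.
  rewrite -kE -doubleS (grid_double T).
  have := noQ _ khalf; rewrite negb_and -ltNge -leNgt => /orP[|//].
  move=> h; have := lt_le_trans h agk.
  rewrite -(grid_double T n) ltr_grid// doubleS kE.
  by rewrite ltnNge leqnSn.
exists n, k; split => //.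
- by rewrite Nn.
- by rewrite agk.
- move=> i _ /andP[agi gib]; case: key => k1 k2.
  apply/eqP; rewrite eqn_leq; apply/andP; split.
    by rewrite -ltnS -(ltr_grid T0 n); exact: lt_le_trans k2.
  rewrite leqNgt; apply/negP => ik.
  have k0 : (0 < k)%N by exact: leq_ltn_trans ik.
  have := lt_le_trans (k1 k0) agi; rewrite ltr_grid// => ki.
  by move: ik; rewrite -(prednK k0) ltnS leqNgt ki.
- case: key => k1 k2; split=> // k0; exact/ltW/k1.
Qed.
End first_grid_point.

(** * Comparison with a dyadic sum on one interval *)

Section local_estimate.
Context {R : realType}.
Variables (T : R) (y : R -> R) (H c : R).
Hypotheses (T0 : 0 < T) (H0 : 0 <= H) (c0 : 0 < c) (c1 : c < 1).
Hypothesis yH : forall n s t, 0 <= s <= T -> 0 <= t <= T ->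
  `|s - t| <= T / 2 ^+ n -> `|y s - y t| <= H * c ^+ n.
Variables (f : R -> R) (o : nat -> nat -> R) (n0 : nat).
Hypothesis o0 : forall n k, 0 <= o n k.
Hypothesis fo : forall n k s t, (n0 <= n)%N -> (k < 2 ^ n)%N ->
  grid T n k <= s <= grid T n k.+1 -> grid T n k <= t <= grid T n k.+1 ->
  `|f s - f t| <= o n k.

Local Notation g := (grid T).

(** A bound for the oscillation on the two cells that meet at the grid point
    [k].  For [k = 0] only the second cell exists, and the first term then merely
    repeats its bound. *)
Definition osc2 n k := o n k.-1 + o n k.

Lemma osc2_ge0 n k : 0 <= osc2 n k.
Proof. exact: addr_ge0. Qed.

Lemma osc_le_osc2 n k a b : (n0 <= n)%N -> (k < 2 ^ n)%N -> 0 <= a ->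
  ((0 < k)%N -> g n k.-1 <= a) -> b <= g n k.+1 ->
  forall s t, a <= s <= b -> a <= t <= b -> `|f s - f t| <= osc2 n k.
Proof.
move=> nn kn a0 ka bk s t /andP[as_ sb] /andP[at_ tb].
have sk : s <= g n k.+1 by exact: le_trans bk.
have tk : t <= g n k.+1 by exact: le_trans bk.
rewrite /osc2.
case: k => [|k] in kn ka bk sk tk *.
  rewrite ler_wpDl//; apply: fo => //; rewrite grid0.
    by rewrite (le_trans a0 as_).
  by rewrite (le_trans a0 at_).
have {}ka := ka isT; rewrite /= in ka *.
have ks : g n k <= s by exact: le_trans as_.
have kt : g n k <= t by exact: le_trans at_.
have gk : g n k <= g n k.+1 <= g n k.+2 by rewrite !ler_grid// !leqnSn.
have kn' := ltnW kn.
have hl u v : g n k <= u -> g n k <= v -> u <= g n k.+1 -> v <= g n k.+1 ->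
    `|f u - f v| <= o n k.
  by move=> *; apply: fo => //; apply/andP.
have hr u v : g n k.+1 <= u -> g n k.+1 <= v -> u <= g n k.+2 ->
    v <= g n k.+2 -> `|f u - f v| <= o n k.+1.
  by move=> *; apply: fo => //; apply/andP.
case/andP: gk => gk1 gk2.
case: (leP s (g n k.+1)) => hs; case: (leP t (g n k.+1)) => ht.
- by rewrite ler_wpDr// hl.
- by apply: le_trans (ler_distD (f (g n k.+1)) _ _) _;
    rewrite lerD// ?hl// hr// ltW.
- apply: le_trans (ler_distD (f (g n k.+1)) _ _) _.
  by rewrite addrC lerD// ?hl// hr// ltW.
- by rewrite ler_wpDl// hr// ltW.
Qed.

(** Telescoping starts at the level [n] of the first grid point [k] of the
    interval.  The cut function is bounded by [osc2 n k], so the single term of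
    the dyadic sum at that level is at most [H * c ^+ n * osc2 n k], and the two
    boundary errors of each later level satisfy the same bound with a
    geometrically decaying factor.  Hence all of them are paid for by the
    summand of index [(n, k)] on the right-hand side.  The remaining errors
    are the oscillations on the cells whose left end lies in the interval.
    Restricting the right-hand side to grid points in [[a, b)] makes the bounds
    for the intervals of a partition add up without repetition. *)
Lemma local_estimate a b tau N m : (n0 <= N)%N -> (N <= m)%N ->
  0 <= a -> b <= T -> a <= tau <= b -> b - a <= T / 2 ^+ N ->
  `|dyadic_sum T y (cut a b (fun t => f t - f tau)) m| <=
  H * (2 + 2 / (1 - c)) * \sum_(N <= n < m.+1) c ^+ n *
    \sum_(0 <= k < 2 ^ n | (a <= g n k < b)%R) osc2 n k.
Proof.
move=> n0N Nm a0 bT taub baN.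
have c0' := ltW c0.
have c1' : 0 < 1 - c by rewrite subr_gt0.
pose W n := \sum_(0 <= k < 2 ^ n | (a <= g n k < b)%R) osc2 n k.
have W0 n : 0 <= W n by apply: sumr_ge0 => k _; exact: osc2_ge0.
rewrite -/(W _).
set Z := \sum_(N <= n < m.+1) _.
have K0 : 0 <= 2 + 2 / (1 - c) by rewrite addr_ge0// divr_ge0// ltW.
have Z0 : 0 <= Z by apply: sumr_ge0 => n _; rewrite mulr_ge0 ?exprn_ge0// W0.
(* Without a grid point of level [m] in the interval, the sum is empty. *)
have [|/existsPn noj] := boolP [exists j : 'I_(2 ^ m), (a <= g m j < b)%R];
    last first.
  rewrite /dyadic_sum big_nat_cond big1 ?normr0 ?mulr_ge0//.
  move=> k /andP[/andP[_ km] _]; rewrite /cut ifF ?mul0r//.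
  by apply/negbTE; exact: (noj (Ordinal km)).
move=> /existsP[[j jm]/= gj].
have [n [k [/andP[Nn nm] kn gk uniqk [ka bk]]]] :=
  first_grid_point T0 a0 bT baN Nm jm gj.
have n0n := leq_trans n0N Nn.
set F := (fun t => _); set om := osc2 n k.
have om0 : 0 <= om by exact: osc2_ge0.
have Fom t : a <= t < b -> `|F t| <= om.
  by move=> /andP[a_ b_]; apply: (@osc_le_osc2 n k a b) => //; rewrite a_ ltW.
have step i : (n0 <= i)%N ->
  `|dyadic_sum T y (cut a b F) i.+1| <= `|dyadic_sum T y (cut a b F) i| +
     H * (c ^+ i * W i + om * (2 * c ^+ i.+1)).
  move=> n0i; have := @dyadic_sum_step R T y H c T0 yH (cut a b F) i.
  have : \sum_(0 <= k < 2 ^ i)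
      `|cut a b F (g i.+1 k.*2.+1) - cut a b F (g i k)| <= W i + om * 2.
    apply: le_trans (_ : _ <= \sum_(0 <= k < 2 ^ i | (a <= g i k < b)%R) o i k
        + om * 2) _.
      apply: cut_osc_le => // l s t li sa ta sg tg.
      by rewrite /F opprB addrA subrK; exact: fo.
    by rewrite lerD2r ler_sum// => l _; rewrite /osc2 lerDr.
  set q := \sum_(_ <= _ < _) _ => qle /= le1.
  have := ler_normD (dyadic_sum T y (cut a b F) i)
    (dyadic_sum T y (cut a b F) i.+1 - dyadic_sum T y (cut a b F) i).
  rewrite subrKC => /le_trans; apply; rewrite lerD2l (le_trans le1)// -mulrA.
  rewrite ler_wpM2l//.
  apply: (@le_trans _ _ (c ^+ i.+1 * (W i + om * 2))).
    by rewrite ler_wpM2l// exprn_ge0.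
  rewrite mulrDr lerD//; last by rewrite mulrCA [X in _ * X]mulrC.
  by rewrite ler_wpM2r// exprS ler_piMl ?exprn_ge0// ltW.
have base : `|dyadic_sum T y (cut a b F) n| <= H * (om * c ^+ n).
  rewrite /dyadic_sum (bigD1_seq k) ?mem_index_iota ?iota_uniq//=.
  rewrite big_nat_cond big1 ?addr0; last first.
    move=> i /andP[/andP[_ im] ik]; rewrite /cut ifF ?mul0r//.
    by apply/negbTE; apply: contra ik => gi; apply/eqP/uniqk.
  rewrite /cut gk normrM mulrCA ler_pM// ?Fom//; apply: yH.
  - by rewrite grid_in.
  - by rewrite grid_in// ltnW.
  - by rewrite gridS addrC addKr ger0_norm// ltW// mesh_gt0.
have ind d : `|dyadic_sum T y (cut a b F) (n + d)| <=
    H * (\sum_(n <= i < n + d) c ^+ i * W i +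
         om * (c ^+ n + 2 * (c ^+ n.+1 * \sum_(0 <= i < d) c ^+ i))).
  elim: d => [|d IH].
    by rewrite addn0 !big_geq// !mulr0 addr0 add0r.
  rewrite addnS (le_trans (step _ _)) ?(leq_trans n0n) ?leq_addr//.
  apply: (le_trans (lerD IH (lexx _))); rewrite -mulrDr ler_wpM2l//.
  rewrite !big_nat_recr ?leq_addr//=.
  rewrite le_eqVlt; apply/orP; left; apply/eqP.
  by rewrite !exprS exprD; ring.
have := ind (m - n)%N; rewrite subnKC// => /le_trans; apply.
rewrite -mulrA ler_wpM2l//.
have omZ : c ^+ n * om <= Z.
  apply: (@le_trans _ _ (c ^+ n * W n)).
    rewrite ler_wpM2l ?exprn_ge0// /W big_mkcond.
    rewrite (bigD1_seq k) ?mem_index_iota ?iota_uniq//= gk lerDl.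
    by apply: sumr_ge0 => i _; case: ifP => // _; exact: osc2_ge0.
  rewrite /Z (bigD1_seq n) ?mem_index_iota ?iota_uniq ?Nn//= -/(W n) lerDl.
  apply: sumr_ge0 => i _; apply: mulr_ge0; [exact: exprn_ge0|exact: W0].
have sumZ : \sum_(n <= i < m) c ^+ i * W i <= Z.
  rewrite /Z (big_cat_nat Nn (leqW nm))/=.
  rewrite ler_wpDl//.
    by apply: sumr_ge0 => i _; apply: mulr_ge0; [exact: exprn_ge0|exact: W0].
  rewrite big_nat_recr//= lerDl; apply: mulr_ge0; [exact: exprn_ge0|exact: W0].
have geo := @sum_geometric_le R c (m - n)%N c0 c1.
set S := \sum_(0 <= i < _) _ in geo *.
have S0 : 0 <= S by apply: sumr_ge0 => i _; rewrite exprn_ge0.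
have -> : om * (c ^+ n + 2 * (c ^+ n.+1 * S)) =
  c ^+ n * om * (1 + 2 * (c * S)) by rewrite exprS; ring.
apply: (@le_trans _ _ (Z + Z * (1 + 2 / (1 - c)))); last first.
  by rewrite le_eqVlt; apply/orP; left; apply/eqP; ring.
rewrite lerD// ler_pM//.
- by rewrite mulr_ge0 ?exprn_ge0.
- by rewrite addr_ge0// !mulr_ge0.
rewrite lerD2l ler_wpM2l// (le_trans _ geo)// ler_piMl// ltW//.
Qed.

End local_estimate.

(** * Convergence of Riemann sums along all partitions *)

Lemma indic_co (R : realDomainType) (a b t : R) : a <= b ->
  (a <= t < b)%R%:R = (t < b)%R%:R - (t < a)%R%:R :> R.
Proof.
move=> ab; case: (leP a t) => at_ /=; first by rewrite subr0.
by rewrite (lt_le_trans at_ ab) subrr.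
Qed.

Lemma bounded_series_tail (R : realType) (u : nat -> R) (B : R) n0 :
  (forall n, 0 <= u n) -> (forall m, \sum_(0 <= n < m) u n <= B) ->
  forall e, 0 < e -> exists2 N, (n0 <= N)%N &
    forall m, (N <= m)%N -> \sum_(N <= n < m) u n <= e.
Proof.
move=> u0 uB e e0.
pose S : set R := range (fun m => \sum_(0 <= n < m) u n).
have hS : has_sup S.
  split; first by exists (\sum_(0 <= n < 0) u n); exists 0%N.
  by exists B => _ [m _ <-].
have [_ [N _ <-] hN] := sup_adherent e0 hS.
exists (maxn n0 N); rewrite ?leq_maxl// => m Nm.
have h : \sum_(0 <= n < m) u n <= sup S.
  by apply: ub_le_sup; [exact: hS.2|exists m].
have Nm' : (N <= m)%N := leq_trans (leq_maxr _ _) Nm.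
move: h; rewrite (big_cat_nat (leq0n N) Nm')/=.
rewrite (big_cat_nat (leq_maxr n0 N) Nm)/= => h.
have : 0 <= \sum_(N <= n < maxn n0 N) u n by apply: sumr_ge0.
lra.
Qed.

Section riemann_sums.
Context {R : realType}.
Variables (T : R) (y : R -> R) (H c : R).
Hypotheses (T0 : 0 < T) (H0 : 0 <= H) (c0 : 0 < c) (c1 : c < 1).
Hypothesis yH : forall n s t, 0 <= s <= T -> 0 <= t <= T ->
  `|s - t| <= T / 2 ^+ n -> `|y s - y t| <= H * c ^+ n.
Local Notation g := (grid T).

(** The increment of [y] over [[0, b)] as seen by the dyadic sums: [b] is rounded
    up to the next grid point. *)
Definition dyadic_incr m b := dyadic_sum T y (fun t => (t < b)%R%:R) m.

(** The sum telescopes up to the cell that contains [b], and [y] varies by at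
    most [H * c ^+ m] on that cell. *)
Lemma dyadic_incr_close m b : 0 <= b <= T ->
  `|dyadic_incr m b - (y b - y 0)| <= H * c ^+ m.
Proof.
move=> /andP[b0 bT].
have Hc : 0 <= H * c ^+ m by rewrite mulr_ge0// exprn_ge0// ltW.
pose u j := \sum_(0 <= k < j) (g m k < b)%R%:R * (y (g m k.+1) - y (g m k)).
have key j : (j <= 2 ^ m)%N -> (g m j <= b -> u j = y (g m j) - y 0) /\
    (b <= g m j -> `|u j - (y b - y 0)| <= H * c ^+ m).
  elim: j => [_|j IH jm].
    rewrite /u big_geq// grid0; split; first by rewrite subrr.
    move=> b0'; have -> : b = 0 by apply: le_anti; rewrite b0 b0'.
    by rewrite !subrr normr0.
  have [IH1 IH2] := IH (ltnW jm).
  rewrite /u big_nat_recr//= -/(u j).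
  have gg : g m j < g m j.+1 by rewrite ltr_grid.
  case: (ltP (g m j) b) => gb; rewrite ?mul1r ?mul0r ?addr0.
    rewrite IH1 ?(ltW gb)//; split => [_|bg]; first by rewrite addrC subrKA.
    rewrite addrC subrKA opprB addrA subrK; apply: yH.
    - exact: grid_in.
    - by rewrite b0.
    - by rewrite ger0_norm ?subr_ge0// lerBlDr gridS addrC lerD2l ltW.
  by split => [gb'|_]; [have := lt_le_trans gg gb'; rewrite ltNge gb|exact: IH2].
by have [_] := key _ (leqnn _); rewrite grid_end; apply.
Qed.

Variables (f : R -> R) (o : nat -> nat -> R) (n0 : nat) (B : R).
Hypothesis o0 : forall n k, 0 <= o n k.
Hypothesis fo : forall n k s t, (n0 <= n)%N -> (k < 2 ^ n)%N ->
  g n k <= s <= g n k.+1 -> g n k <= t <= g n k.+1 ->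
  `|f s - f t| <= o n k.
Hypothesis oB : forall m,
  \sum_(0 <= n < m) c ^+ n * \sum_(0 <= k < 2 ^ n) o n k <= B.

Lemma sum_osc2_le n :
  \sum_(0 <= k < 2 ^ n) osc2 o n k <= 3 * \sum_(0 <= k < 2 ^ n) o n k.
Proof.
rewrite /osc2 big_split/=.
suff : \sum_(0 <= k < 2 ^ n) o n k.-1 <= 2 * \sum_(0 <= k < 2 ^ n) o n k by lra.
have : (0 < 2 ^ n)%N by rewrite expn_gt0.
case: (2 ^ n)%N => // j _; rewrite [leLHS]big_nat_recl//=.
have h1 : o n 0 <= \sum_(0 <= k < j.+1) o n k.
  by rewrite big_nat_recl// lerDl sumr_ge0.
have h2 : \sum_(0 <= k < j) o n k <= \sum_(0 <= k < j.+1) o n k.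
  by rewrite big_nat_recr//= lerDl.
by lra.
Qed.

(** For [m] tending to infinity the sum on the left tends to the Riemann sum,
    while the bound on the right stays below the tail from level [N]. *)
Lemma riemann_dyadic_close (K : nat) (p tau : nat -> R) N m :
  (n0 <= N)%N -> (N <= m)%N -> p 0%N = 0 -> p K = T ->
  (forall i, (i < K)%N -> p i <= tau i <= p i.+1) ->
  (forall i, (i < K)%N -> p i.+1 - p i <= T / 2 ^+ N) ->
  `|dyadic_sum T y f m - \sum_(0 <= i < K) f (tau i) *
      (dyadic_incr m (p i.+1) - dyadic_incr m (p i))| <=
  H * (2 + 2 / (1 - c)) * 3 *
    \sum_(N <= n < m.+1) c ^+ n * \sum_(0 <= k < 2 ^ n) o n k.
Proof.
move=> n0N Nm p0 pK ptau pmesh.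
have c1' : 0 < 1 - c by rewrite subr_gt0.
have pS i : (i < K)%N -> p i <= p i.+1.
  by move=> iK; have /andP[/le_trans] := ptau _ iK; apply.
have pge0 i : (i <= K)%N -> 0 <= p i.
  elim: i => [|i IH] iK; first by rewrite p0.
  by rewrite (le_trans (IH (ltnW iK)))// pS.
have pleT i : (i <= K)%N -> p i <= T.
  move=> iK; rewrite -(subKn iK); elim: (K - i)%N => [|j IH].
    by rewrite subn0 pK.
  case: (leqP K j) => jK.
    by have /eqP -> : (K - j.+1 == 0)%N; [rewrite subn_eq0 ltnW|rewrite p0 ltW].
  rewrite (le_trans _ IH)// -(subnSK jK).
  by apply: pS; rewrite subnSK// leq_subr.
(* The intervals [[p i, p i.+1)] partition [[0, T)]. *)
pose incr i t : R := (p i <= t < p i.+1)%R%:R.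
have one t : 0 <= t < T -> \sum_(0 <= i < K) incr i t = 1.
  move=> /andP[t0 tT]; under eq_big_nat => i /andP[_ iK] do
    rewrite /incr indic_co ?pS//.
  by rewrite telescope_sumr// pK p0 tT ltNge t0 subr0.
have -> : dyadic_sum T y f m - \sum_(0 <= i < K) f (tau i) *
      (dyadic_incr m (p i.+1) - dyadic_incr m (p i)) =
    \sum_(0 <= i < K)
       dyadic_sum T y (cut (p i) (p i.+1) (fun t => f t - f (tau i))) m.
  transitivity (\sum_(0 <= i < K) \sum_(0 <= k < 2 ^ m)
     (incr i (g m k) * (f (g m k) - f (tau i)) *
       (y (g m k.+1) - y (g m k)))); last first.
    apply: eq_bigr => i _; apply: eq_bigr => k _; rewrite /cut /incr.
    by case: ifP => _; rewrite ?mul1r// !mul0r.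
  transitivity (\sum_(0 <= i < K)
    (\sum_(0 <= k < 2 ^ m) incr i (g m k) * f (g m k) *
         (y (g m k.+1) - y (g m k))
     - f (tau i) * (dyadic_incr m (p i.+1) - dyadic_incr m (p i)))).
    rewrite sumrB; congr (_ - _); rewrite exchange_big/=.
    apply: eq_big_nat => k /andP[_ km].
    rewrite -mulr_suml -mulr_suml one ?mul1r//.
    have /andP[-> _] := @grid_in _ T T0 m k (ltnW km).
    by rewrite -[ltRHS](grid_end T m) ltr_grid.
  apply: eq_big_nat => i /andP[_ iK].
  rewrite /dyadic_incr /dyadic_sum -sumrB mulr_sumr -sumrB.
  by apply: eq_bigr => k _; rewrite /incr indic_co ?pS//; ring.
apply: (le_trans (ler_norm_sum _ _ _)).
pose M := H * (2 + 2 / (1 - c)).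
have M0 : 0 <= M by rewrite mulr_ge0// addr_ge0// divr_ge0// ltW.
apply: (@le_trans _ _ (\sum_(0 <= i < K) M * \sum_(N <= n < m.+1)
    c ^+ n * \sum_(0 <= k < 2 ^ n) incr i (g n k) * osc2 o n k)).
  apply: ler_sum_nat_in => i /andP[_ iK].
  have := @local_estimate R T y H c T0 H0 c0 c1 yH f o n0 o0 fo
    (p i) (p i.+1) (tau i) N m n0N Nm (pge0 _ (ltnW iK)) (pleT _ iK)
    (ptau _ iK) (pmesh _ iK).
  move=> /le_trans; apply; rewrite -/M ler_wpM2l//.
  rewrite le_eqVlt; apply/orP; left; apply/eqP; apply: eq_bigr => n _.
  congr (_ * _); rewrite big_mkcond; apply: eq_bigr => k _.
  by rewrite /incr; case: ifP; rewrite ?mul1r ?mul0r.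
rewrite -mulr_sumr -/M -mulrA ler_wpM2l// exchange_big/= mulr_sumr.
apply: ler_sum => n _; rewrite -mulr_sumr mulrCA ler_wpM2l ?exprn_ge0 ?(ltW c0)//.
rewrite exchange_big/= (le_trans _ (sum_osc2_le n))//.
apply: ler_sum_nat_in => k /andP[_ kn]; rewrite -mulr_suml one ?mul1r//.
have /andP[-> _] := @grid_in _ T T0 n k (ltnW kn).
by rewrite -[ltRHS](grid_end T n) ltr_grid.
Qed.

Lemma dyadic_sum_cvg : cvgn (dyadic_sum T y f).
Proof.
pose S n := \sum_(0 <= k < 2 ^ n) o n k.
have S0 n : 0 <= S n by apply: sumr_ge0.
have c0' := ltW c0.
have step n : (n0 <= n)%N ->
    `|dyadic_sum T y f n.+1 - dyadic_sum T y f n| <= H * (c ^+ n * S n).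
  move=> n0n; apply: (le_trans (@dyadic_sum_step R T y H c T0 yH f n)).
  rewrite -mulrA ler_wpM2l//; apply: (@le_trans _ _ (c ^+ n.+1 * S n)).
    rewrite ler_wpM2l ?exprn_ge0//; apply: ler_sum_nat_in => k /andP[_ kn].
    have /andP[gm mg] := grid_mid_in T0 n k.
    by apply: fo => //; rewrite ?gm// lexx (le_trans gm mg).
  by rewrite ler_wpM2r// exprS ler_piMl ?exprn_ge0// ltW.
apply: cauchy_cvg; apply: cauchy_exP => e e0.
have H1 : 0 < H + 1 by rewrite ltr_wpDl.
have e1 : 0 < e / 2 / (H + 1) by rewrite !divr_gt0.
have [N n0N hN] := @bounded_series_tail R (fun n => c ^+ n * S n) B n0
  (fun n => mulr_ge0 (exprn_ge0 _ c0') (S0 n)) oB _ e1.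
exists (dyadic_sum T y f N); exists N => //= m /= Nm.
rewrite /ball/= distrC -telescope_sumr//.
apply: (le_lt_trans (ler_norm_sum _ _ _)).
apply: (@le_lt_trans _ _ (\sum_(N <= n < m) H * (c ^+ n * S n))).
  by apply: ler_sum_nat_in => n /andP[Nn _]; apply: step; exact: leq_trans Nn.
rewrite -mulr_sumr.
apply: (@le_lt_trans _ _ (H * (e / 2 / (H + 1)))).
  by rewrite ler_wpM2l// hN.
apply: (@le_lt_trans _ _ (e / 2)); last by lra.
by rewrite mulrCA ler_piMr ?divr_ge0 ?(ltW e0)// ler_pdivrMr// mul1r lerDl.
Qed.

Theorem riemann_sums_cvg e : 0 < e -> exists N, forall K p tau,
  p 0%N = 0 -> p K = T ->
  (forall i, (i < K)%N -> p i <= tau i <= p i.+1) ->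
  (forall i, (i < K)%N -> p i.+1 - p i <= T / 2 ^+ N) ->
  `|limn (dyadic_sum T y f) -
    \sum_(0 <= i < K) f (tau i) * (y (p i.+1) - y (p i))| <= e.
Proof.
move=> e0.
have c0' := ltW c0.
have c1' : 0 < 1 - c by rewrite subr_gt0.
pose M := H * (2 + 2 / (1 - c)) * 3.
have M0 : 0 <= M by rewrite mulr_ge0// mulr_ge0// addr_ge0// divr_ge0// ltW.
have M1 : 0 < M + 1 by rewrite ltr_wpDl.
have e1 : 0 < e / (M + 1) by rewrite !divr_gt0.
have [N n0N hN] := @bounded_series_tail R
  (fun n => c ^+ n * \sum_(0 <= k < 2 ^ n) o n k) B n0
  (fun n => mulr_ge0 (exprn_ge0 _ c0') (sumr_ge0 _ (fun k _ => o0 n k))) oB _ e1.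
exists N => K p tau p0 pK ptau pmesh.
have pin i : (i <= K)%N -> 0 <= p i <= T.
  have pS j : (j < K)%N -> p j <= p j.+1.
    by move=> jK; have /andP[/le_trans] := ptau _ jK; apply.
  have mono j : (j <= K)%N -> forall l, (l <= j)%N -> p l <= p j.
    elim: j => [_ [|//]//|j IH jK l]; rewrite leq_eqVlt => /orP[/eqP->//|lj].
    exact: le_trans (IH (ltnW jK) _ lj) (pS _ jK).
  by move=> iK; rewrite -{1}p0 -pK !mono.
have incr_cvg i : (i <= K)%N ->
    dyadic_incr m (p i) @[m --> \oo] --> y (p i) - y 0.
  move=> iK; apply/cvgrPdist_le => d d0.
  have H1 : 0 < H + 1 by rewrite ltr_wpDl.
  have : c ^+ n @[n --> \oo] --> (0 : R) by apply: cvg_expr; rewrite ger0_norm.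
  move=> /cvgrPdist_le/(_ (d / (H + 1)) (divr_gt0 d0 H1)); apply: filterS => n.
  rewrite sub0r normrN ger0_norm ?exprn_ge0// => cn.
  rewrite distrC (le_trans (dyadic_incr_close n (pin i iK)))//.
  apply: (@le_trans _ _ (H * (d / (H + 1)))); first by rewrite ler_wpM2l.
  by rewrite mulrCA ler_piMr ?(ltW d0)// ler_pdivrMr// mul1r lerDl.
have cvg_all : dyadic_sum T y f m - \sum_(0 <= i < K) f (tau i) *
      (dyadic_incr m (p i.+1) - dyadic_incr m (p i)) @[m --> \oo] -->
   limn (dyadic_sum T y f) -
    \sum_(0 <= i < K) f (tau i) * (y (p i.+1) - y (p i)).
  apply: cvgB; first exact: dyadic_sum_cvg.
  rewrite big_nat_cond; under eq_fun do rewrite big_nat_cond.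
  apply: cvg_big => [|i /andP[/andP[_ iK] _]]; first exact: add_continuous.
  apply: (@cvgM _ _ _ _ (cst (f (tau i)))); first exact: cvg_cst.
  rewrite (_ : y (p i.+1) - y (p i) = (y (p i.+1) - y 0) - (y (p i) - y 0)).
    by apply: cvgB; apply: incr_cvg => //; exact: ltnW.
  by rewrite opprB addrA subrK.

rewrite -(cvg_lim _ (cvg_norm cvg_all))//.
apply: limr_le; first by apply/cvg_ex; eexists; exact: (cvg_norm cvg_all).
exists N => //= m Nm.
apply: (le_trans (riemann_dyadic_close n0N Nm p0 pK ptau pmesh)).
apply: (@le_trans _ _ (M * (e / (M + 1)))).
  by rewrite ler_wpM2l// hN// leqW.
by rewrite mulrCA ler_piMr ?(ltW e0)// ler_pdivrMr// mul1r lerDl.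
Qed.

End riemann_sums.

(** * Expected oscillation of a function of bounded variation *)

(** Otherwise [`|g|] would exceed its mean by more than one almost everywhere
    on the interval.  Working at one such time per dyadic cell replaces
    an integration over time, which would have to be exchanged with the
    expectation and so require a jointly measurable process. *)
Lemma below_average_time (R : realType) (T u v : R) (g : R -> R) (Q : R -> Prop) :
  0 <= u -> u < v -> v <= T ->
  lebesgue_measure.-integrable `[0, T] (EFin \o g) ->
  {ae lebesgue_measure, forall t : R, t \in `[0, T] -> Q t} ->
  exists t, [/\ u <= t <= v, Q t & `|g t| * (v - u) <=
    \int[lebesgue_measure]_(x in `[0, v]) `|g x| -
    \int[lebesgue_measure]_(x in `[0, u]) `|g x| + (v - u)].
Proof.
move=> u0 uv vT ig aeQ; have vu0 : 0 < v - u by rewrite subr_gt0.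
have iN : lebesgue_measure.-integrable `[0, T] (EFin \o (fun x => `|g x|)).
  have := integrable_norm ig; apply: eq_integrable => //.
have iN0v : lebesgue_measure.-integrable `[0, v] (EFin \o (fun x => `|g x|)).
  by apply: integrableS iN => //; apply: subset_itvl; rewrite bnd_simp.
have iNuv : lebesgue_measure.-integrable `]u, v] (EFin \o (fun x => `|g x|)).
  by apply: integrableS iN0v => //; apply: subset_itvr; rewrite bnd_simp.
rewrite Rintegral_itvB ?bnd_simp//; last exact: ltW.
set I := Rintegral _ _ _.
have I0 : 0 <= I by apply: Rintegral_ge0.
apply: contrapT => /forallNP none.
pose K := I / (v - u) + 1.
have K0 : 0 <= K by rewrite addr_ge0// divr_ge0// ltW.
have : (\int[lebesgue_measure]_(x in `]u, v]) (cst K%:E x) <=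
        \int[lebesgue_measure]_(x in `]u, v]) (`|g x|)%:E)%E.
  apply: ae_ge0_le_integral => //.
  - exact: (measurable_int lebesgue_measure).
  - apply: (@filterS _ _ (ae_filter_ringOfSetsType _) _ _ _ aeQ) => t Qt.
    rewrite /= in_itv/= => /andP[ut tv].
    have /Qt{}Qt : t \in `[0, T] by rewrite in_itv/=; apply/andP; split; lra.
    rewrite lee_fin leNgt; apply/negP => gK; apply: (none t); split => //.
      by rewrite (ltW ut).
    rewrite (le_trans (ler_wpM2r (ltW vu0) (ltW gK)))//.
    by rewrite /K mulrDl mul1r divfK// gt_eqF.
rewrite integral_cst//= lebesgue_measure_itv/= lte_fin uv -EFinB -EFinM.
have -> : (\int[lebesgue_measure]_(x in `]u, v]) (`|g x|)%:E = I%:E)%E.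
  by rewrite /I /Rintegral fineK//; exact: integrable_fin_num.
rewrite lee_fin /K mulrDl mul1r divfK ?gt_eqF//; lra.
Qed.

(** [V] is the total variation of [g] on [[- M, x]], with [x] projected to
    [[- M, M]]. *)
Lemma BV_loc_controlled (R : realType) (g : R -> R) (M : R) :
  BV_loc g -> 0 <= M -> exists (V : R -> R) (B : R),
    [/\ {homo V : x y / x <= y}, forall x, 0 <= V x <= B &
        forall x y, - M <= x -> x <= y -> y <= M -> `|g x - g y| <= V y - V x].
Proof.
move=> gBV M0; have MM : - M <= M by lra.
have bv := gBV _ _ MM.
pose cl x := Num.max (- M) (Num.min x M).
have clin x : - M <= cl x <= M.
  by rewrite /cl le_max lexx/= ge_max MM ge_min lexx orbT.
have clhomo : {homo cl : x y / x <= y}.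
  by move=> x y xy; rewrite /cl le_max2// le_min2.
pose V x := fine (total_variation (- M) (cl x) g).
have fin x : -M <= x <= M -> total_variation (- M) x g \is a fin_num.
  move=> /andP[Mx xM]; apply/bounded_variationP => //.
  exact: bounded_variationl bv.
have Vhomo : {homo V : x y / x <= y}.
  move=> x y xy; apply: fine_le; rewrite ?fin//.
  by apply: (@total_variation_nondecreasing _ (-M) M); rewrite ?in_itv ?clin//=;
     exact: clhomo.
exists V, (V M); split => //.
- move=> x; rewrite fine_ge0/=; last first.
    by apply: total_variation_ge0; case/andP: (clin x).
  case: (leP x M) => [/Vhomo//|/ltW Mx].
  rewrite /V (_ : cl x = cl M)// /cl.
  by rewrite (min_r Mx) minxx.
- move=> x y Mx xy yM.
  have clE z : - M <= z -> z <= M -> cl z = z.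
    by move=> h1 h2; rewrite /cl (min_l h2) (max_r h1).
  rewrite /V !clE ?(le_trans Mx xy) ?(le_trans xy yM)//.
  rewrite (total_variationD g Mx xy) fineD; last 2 first.
  - by rewrite fin// Mx (le_trans xy).
  - have : total_variation (-M) y g \is a fin_num.
      by rewrite fin// (le_trans Mx xy).
    rewrite (total_variationD g Mx xy) fin_numD => /andP[]//.
  rewrite [leRHS]addrC addKr distrC -lee_fin fineK ?total_variation_ge//.
  have : total_variation (-M) y g \is a fin_num by rewrite fin// (le_trans Mx xy).
  by rewrite (total_variationD g Mx xy) fin_numD => /andP[].
Qed.

Section space_cells.
Context {R : realType}.
Variables (V : R -> R) (B M rho : R).
Hypotheses (Vhomo : {homo V : x y / x <= y}) (VB : forall x, 0 <= V x <= B).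
Hypotheses (M0 : 0 <= M) (rho0 : 0 < rho).

(** Space is cut into cells of length [rho], so that the mass of a ball of radius
    [rho] around a random point is bounded by a simple function of that point,
    whose expectation only involves the probabilities of the cells. *)
Definition cell_end (j : nat) : R := - M + j%:R * rho.

Definition cell (j : nat) : set R := `[cell_end j, cell_end j.+1[.

Definition cell_weight (j : nat) : R :=
  V (cell_end j + rho + rho) - V (cell_end j - rho).

Definition cell_count : nat := (Num.truncn (2 * M / rho)).+1.

Definition cell_osc (z : R) : R :=
  \sum_(0 <= j < cell_count) cell_weight j * \1_(cell j) z.

Lemma cell_weight_ge0 j : 0 <= cell_weight j.
Proof. by rewrite subr_ge0; apply: Vhomo; move: rho0; lra. Qed.

Lemma cell_osc_ge0 z : 0 <= cell_osc z.
Proof. by apply: sumr_ge0 => j _; rewrite mulr_ge0 ?cell_weight_ge0// ler0n. Qed.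

(** A ball of radius [rho] around a point of a cell is covered by the cell
    and its two neighbours. *)
Lemma cell_osc_ge z : `|z| < M -> V (z + rho) - V (z - rho) <= cell_osc z.
Proof.
rewrite ltr_norml => /andP[Mz zM].
pose j := Num.truncn ((z + M) / rho).
have q0 : 0 <= (z + M) / rho by rewrite divr_ge0 ?(ltW rho0)//; lra.
have jle : j%:R * rho <= z + M by rewrite -ler_pdivlMr// truncn_le.
have jlt : z + M < j.+1%:R * rho by rewrite -ltr_pdivrMr// truncnS_gt.
have jL : (j < cell_count)%N.
  rewrite ltnS; apply: le_truncn; rewrite ler_pM2r ?invr_gt0//; lra.
have zj : z \in cell j.
  by rewrite inE /cell/= in_itv/= /cell_end; apply/andP; split; lra.
rewrite /cell_osc (bigD1_seq j) ?mem_index_iota ?iota_uniq//= indicE zj mulr1.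
apply: ler_wpDr.
  by apply: sumr_ge0 => i _; rewrite mulr_ge0 ?cell_weight_ge0// ler0n.
move: jlt; rewrite -natr1 mulrDl mul1r => jlt.
by apply: lerB; apply: Vhomo; rewrite /cell_end; lra.
Qed.

(** Each weight is the increment of [V] over three consecutive cells, so every
    cell is counted three times. *)
Lemma sum_cell_weight_le : \sum_(0 <= j < cell_count) cell_weight j <= 3 * B.
Proof.
pose u j := V (cell_end j - rho).
have uS j : cell_end j.+1 = cell_end j + rho.
  by rewrite /cell_end -natr1 mulrDl mul1r addrA.
have := @telescope_le R cell_weight (fun j => u j + u j.+1 + u j.+2) cell_count.
move=> /(_ _)/le_trans; apply.
  move=> j _; rewrite /u /cell_weight !uS.
  rewrite (_ : cell_end j + rho + rho + rho - rho = cell_end j + rho + rho);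
    last by ring.
  by lra.
have h j : 0 <= u j <= B by exact: VB.
have := h 0%N; have := h 1%N; have := h 2%N.
have := h cell_count; have := h cell_count.+1; have := h cell_count.+2.
by lra.
Qed.

Context d (Omega : measurableType d) (P : probability Omega R).

Lemma measurable_cell_osc : measurable_fun setT cell_osc.
Proof.
apply: measurable_sum => j; apply: measurable_funM => //.
by apply: measurable_indic; exact: measurable_itv.
Qed.

(** Since the weights add up to at most [3 * B], a bound on the probability of
    a single cell suffices. *)
Lemma expectation_cell_osc (Z : {RV P >-> R}) (G : R) :
  (forall j, (P (Z @^-1` cell j) <= (G * rho)%:E)%E) ->
  (\int[P]_w (cell_osc (Z w))%:E <= (3 * B * (G * rho))%:E)%E.
Proof.
move=> hP.
have mZ : measurable_fun setT Z by [].
have mcell j : measurable (Z @^-1` cell j).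
  by rewrite -[X in measurable X]setTI; apply: mZ => //; exact: measurable_itv.
have -> : (\int[P]_w (cell_osc (Z w))%:E =
   \sum_(0 <= j < cell_count) (cell_weight j)%:E * P (Z @^-1` cell j))%E.
  under eq_integral do rewrite /cell_osc -sumEFin.
  rewrite ge0_integral_sum//.
  - apply: eq_bigr => j _; under eq_integral do rewrite EFinM.
    rewrite ge0_integralZl_EFin ?cell_weight_ge0//.
    + by rewrite -(setIT (Z @^-1` _)) -integral_indic.
    + apply/measurable_EFinP; apply: (measurableT_comp _ mZ).
      by apply: measurable_indic; exact: measurable_itv.
  - move=> j; apply/measurable_EFinP; apply: measurable_funM => //.
    apply: (measurableT_comp _ mZ); apply: measurable_indic.
    exact: measurable_itv.
  - by move=> j w _; rewrite lee_fin mulr_ge0 ?cell_weight_ge0// ler0n.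
have G0 : 0 <= G * rho.
  by rewrite -lee_fin (le_trans _ (hP 0%N)).
apply: (@le_trans _ _
    (\sum_(0 <= j < cell_count) (cell_weight j * (G * rho))%:E)%E).
  by apply: lee_sum => j _; rewrite EFinM lee_pmul ?lee_fin ?cell_weight_ge0.
by rewrite sumEFin lee_fin -mulr_suml ler_wpM2r// sum_cell_weight_le.
Qed.

End space_cells.

Lemma density_cell_prob d (Omega : measurableType d) (R : realType)
  (P : probability Omega R) (Z : {RV P >-> R}) (p : R -> R) (G a b : R) :
  is_density Z p -> (forall x, p x <= G) -> a < b ->
  (P (Z @^-1` `[a, b[) <= (G * (b - a))%:E)%E.
Proof.
move=> [mp p0 dp] pG ab.
have := dp `[a, b[%classic (measurable_itv _).
rewrite /distribution/= /pushforward => ->.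
apply: (@le_trans _ _ (\int[lebesgue_measure]_(x in `[a, b[) (cst G%:E x))%E).
  apply: ge0_le_integral => //.
  - by move=> x _; rewrite lee_fin.
  - by apply/measurable_EFinP; exact: measurable_funTS.
  - by move=> x _; rewrite lee_fin.
by rewrite integral_cst//= lebesgue_measure_itv/= lte_fin ab -EFinB -EFinM.
Qed.

(** * Almost sure control of the oscillations *)

Lemma holder_on_dyadic (R : realType) (T a : R) (f : R -> R) :
  0 < T -> 0 < a -> holder_on T a f -> exists2 H, 0 <= H &
    forall n s t, 0 <= s <= T -> 0 <= t <= T -> `|s - t| <= T / 2 ^+ n ->
      `|f s - f t| <= H * (2 `^ (- a)) ^+ n.
Proof.
move=> T0 a0 [C fC]; exists (`|C| * T `^ a).
  by rewrite mulr_ge0// powR_ge0.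
move=> n s t sT tT st; apply: (le_trans (fC s t _ _)); rewrite ?in_itv//.
apply: (@le_trans _ _ (`|C| * `|s - t| `^ a)).
  by rewrite ler_wpM2r ?powR_ge0// ler_norm.
rewrite -mulrA ler_wpM2l//.
have -> : T `^ a * (2 `^ (- a)) ^+ n = (T / 2 ^+ n) `^ a.
  rewrite powRM ?(ltW T0) ?invr_ge0 ?exprn_ge0//; congr (_ * _).
  rewrite -powR_mulrn ?powR_ge0// -powRrM mulNr mulrC -mulNr powRrM.
  by rewrite powRN powR_mulrn.
by rewrite ge0_ler_powR// ?nnegrE ?(ltW a0)// divr_ge0 ?(ltW T0)// exprn_ge0.
Qed.

(** A nonnegative series with finite expectation is finite almost surely. *)
Lemma ae_bounded_series d (Omega : measurableType d) (R : realType)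
    (P : probability Omega R) (a : nat -> Omega -> R) (D r : R) :
  (forall n, measurable_fun setT (a n)) -> (forall n w, 0 <= a n w) ->
  0 < r -> r < 1 -> 0 <= D ->
  (forall n, (\int[P]_w (a n w)%:E <= (D * r ^+ n)%:E)%E) ->
  {ae P, forall w, exists B, forall m, \sum_(0 <= n < m) a n w <= B}.
Proof.
move=> ma a0 r0 r1 D0 aD.
pose h w := (\sum_(n <oo) (a n w)%:E)%E.
have h0 w : (0 <= h w)%E by apply: nneseries_ge0 => n _ _; rewrite lee_fin.
have mah n : measurable_fun setT (fun w => (a n w)%:E).
  exact/measurable_EFinP.
have mh : measurable_fun setT h.
  by apply: ge0_emeasurable_sum => // n w _ _; rewrite lee_fin.
have ih : P.-integrable setT h.
  apply/integrableP; split => //.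
  under eq_integral do rewrite gee0_abs//.
  rewrite integral_nneseries//; last by move=> n w _; rewrite lee_fin.
  apply: (@le_lt_trans _ _ (D / (1 - r))%:E); last exact: ltry.
  apply: lime_le.
    apply: is_cvg_nneseries => n _ _; apply: integral_ge0 => w _.
    by rewrite lee_fin.
  apply: nearW => m; apply: (@le_trans _ _ (\sum_(0 <= n < m) (D * r ^+ n)%:E)%E).
    exact: lee_sum.
  rewrite sumEFin lee_fin -mulr_sumr ler_wpM2l// sum_geometric_le//.
have := integrable_ae measurableT ih.
apply: filterS => w /(_ I) hw; exists (fine (h w)) => m.
rewrite -lee_fin fineK// -sumEFin.
by apply: nneseries_lim_ge => n _ _; rewrite lee_fin.
Qed.

Section sampled_oscillations.
Context d (Omega : measurableType d) (R : realType) (P : probability Omega R).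
Variables (T : R) (Z : R -> {RV P >-> R}).
Hypotheses (T0 : 0 < T) (ZD : assumption_D T Z).
Local Notation g := (grid T).

(** One time per dyadic cell.  [G n k] bounds the density at the time [ts n k],
    and the averages of these bounds over the cells of a level are bounded
    independently of the level because the integrals over the cells add up to
    the integral over [[0, T]]. *)
Lemma sample_times : exists (ts : nat -> nat -> R) (G : nat -> nat -> R) (D : R),
  [/\ forall n k, (k < 2 ^ n)%N -> g n k <= ts n k <= g n k.+1,
      forall n k a b, (k < 2 ^ n)%N -> a < b ->
        (P (Z (ts n k) @^-1` `[a, b[) <= (G n k * (b - a))%:E)%E,
      0 <= D &
      forall n, \sum_(0 <= k < 2 ^ n) G n k <= D * 2 ^+ n].
Proof.
case: ZD => p [b [pZ ib pb]].
pose Q t := is_density (Z t) (p t) /\ forall y, p t y <= b t.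
have aeQ : {ae lebesgue_measure, forall t : R, t \in `[0, T] -> Q t}.
  apply: (@filterS2 _ _ (ae_filter_ringOfSetsType _) _ _ _ _ pZ pb).
  by move=> t h1 h2 tT; split; [exact: h1|exact: h2].
pose F v := \int[lebesgue_measure]_(x in `[0, v]) `|b x|.
have ex n k : exists t, (k < 2 ^ n)%N -> [/\ g n k <= t <= g n k.+1, Q t &
    `|b t| * (T / 2 ^+ n) <= F (g n k.+1) - F (g n k) + T / 2 ^+ n].
  case: (ltnP k (2 ^ n)) => kn; last by exists 0.
  have /andP[gk0 _] := grid_in T0 (ltnW kn).
  have /andP[_ gkT] := grid_in T0 kn.
  have gk : g n k < g n k.+1 by rewrite ltr_grid.
  have [t [tk Qt]] := below_average_time gk0 gk gkT ib aeQ.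
  have -> : g n k.+1 - g n k = T / 2 ^+ n by rewrite gridS addrC addKr.
  by exists t.
pose ts n k := projT1 (cid (ex n k)).
have tsP n k (kn : (k < 2 ^ n)%N) := projT2 (cid (ex n k)) kn.
exists ts, (fun n k => `|b (ts n k)|), ((F T - F 0) / T + 1).
have F0T : 0 <= F T - F 0.
  rewrite /F Rintegral_itvB ?bnd_simp ?(ltW T0)//; first exact: Rintegral_ge0.
  by have := integrable_norm ib; apply: eq_integrable.
split.
- by move=> n k kn; have [] := tsP n k kn.
- move=> n k u v kn uv; have [_ [dZ pZb] _] := tsP n k kn.
  by apply: density_cell_prob dZ _ uv => x; rewrite (le_trans (pZb x))// ler_norm.
- by rewrite addr_ge0// divr_ge0// ltW.
- move=> n; have m0 := mesh_gt0 T0 n.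
  rewrite -(ler_pM2r m0) mulr_suml.
  apply: (@le_trans _ _ (\sum_(0 <= k < 2 ^ n)
       ((F (g n k.+1) - F (g n k)) + T / 2 ^+ n))).
    by apply: ler_sum_nat_in => k /andP[_ kn]; have [] := tsP n k kn.
  rewrite big_split/= telescope_sumr// grid_end grid0.
  rewrite big_const_nat subn0 iter_addr_0 -(mulr_natl _ (2 ^ n)) natrX.
  have : (2 ^+ n : R) != 0 by rewrite expf_neq0.
  have Tn0 : T != 0 by rewrite gt_eqF.
  move=> n0; rewrite le_eqVlt; apply/orP; left; apply/eqP.
  by field; rewrite n0.
Qed.

Variables (ts G : nat -> nat -> R) (D : R).
Hypothesis tsG : forall n k a b, (k < 2 ^ n)%N -> a < b ->
  (P (Z (ts n k) @^-1` `[a, b[) <= (G n k * (b - a))%:E)%E.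
Hypothesis D0 : 0 <= D.
Hypothesis GD : forall n, \sum_(0 <= k < 2 ^ n) G n k <= D * 2 ^+ n.

(** With radius [q ^+ n] at level [n], the expected oscillations at level [n]
    add up to at most a constant times [2 ^+ n * q ^+ n]: the series is dominated
    in mean by a geometric one of ratio [2 * c * q]. *)
Lemma ae_sampled_osc (V : R -> R) (B M c q : R) :
  {homo V : x y / x <= y} -> (forall x, 0 <= V x <= B) -> 0 <= M ->
  0 < c -> 0 < q -> 2 * c * q < 1 ->
  {ae P, forall w, exists S, forall m, \sum_(0 <= n < m) c ^+ n *
     \sum_(0 <= k < 2 ^ n) cell_osc V M (q ^+ n) (Z (ts n k) w) <= S}.
Proof.
move=> Vh VB M0 c0 q0 cq1.
have q0n n : 0 < q ^+ n by rewrite exprn_gt0.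
have B0 : 0 <= B by case/andP: (VB 0) => h /(le_trans h).
have mosc n k :
    measurable_fun setT (fun w => cell_osc V M (q ^+ n) (Z (ts n k) w)).
  apply: (measurableT_comp (@measurable_cell_osc R V M (q ^+ n))) => //.
have osc0 n z : 0 <= cell_osc V M (q ^+ n) z by exact: cell_osc_ge0.
apply: (@ae_bounded_series _ _ _ P (fun n w => c ^+ n * _) (3 * B * D)
  (2 * c * q)).
- move=> n; apply: measurable_funM => //.
  exact: measurable_sum.
- by move=> n w; rewrite mulr_ge0 ?exprn_ge0 ?(ltW c0)//; apply: sumr_ge0 => k _.
- by rewrite !mulr_gt0.
- exact: cq1.
- by rewrite !mulr_ge0.
move=> n; have cn0 : 0 <= c ^+ n by rewrite exprn_ge0// ltW.
under eq_integral do rewrite EFinM -sumEFin.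
rewrite ge0_integralZl_EFin//; last 2 first.
- by move=> w _; apply: sume_ge0 => k _; rewrite lee_fin.
- by apply: emeasurable_sum => k; apply/measurable_EFinP.
rewrite ge0_integral_sum//; last 2 first.
- by move=> k; apply/measurable_EFinP.
- by move=> k w _; rewrite lee_fin.
have -> : (3 * B * D * (2 * c * q) ^+ n)%:E =
    ((c ^+ n)%:E * (3 * B * q ^+ n * (D * 2 ^+ n))%:E)%E.
  by rewrite -EFinM; congr EFin; rewrite !exprMn; ring.
rewrite lee_wpmul2l ?lee_fin//.
apply: (@le_trans _ _ (\sum_(0 <= k < 2 ^ n) (3 * B * q ^+ n * G n k)%:E)%E).
  rewrite big_nat_cond [leRHS]big_nat_cond.
  apply: lee_sum => k /andP[/andP[_ kn] _].
  rewrite -mulrA (mulrC (q ^+ n)).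
  apply: expectation_cell_osc => // j.
  have jj : cell_end M (q ^+ n) j < cell_end M (q ^+ n) j.+1.
    by rewrite /cell_end -natr1 mulrDl mul1r addrA ltrDl.
  apply: (le_trans (tsG kn jj)).
  by rewrite lee_fin /cell_end -natr1 mulrDl mul1r addrA [X in _ * X]addrC addKr.
by rewrite sumEFin lee_fin -mulr_sumr ler_wpM2l ?GD// !mulr_ge0// ltW.
Qed.

End sampled_oscillations.

Lemma ltr_pow2 (R : realType) (x y : R) : x < y -> 2 `^ x < 2 `^ y.
Proof.
move=> xy; rewrite /powR !ifF ?pnatr_eq0// ltr_expR ltr_pM2r//.
by rewrite ln_gt0// ltr1n.
Qed.

Lemma geometric_dominated (R : realType) (H a q : R) :
  0 <= H -> 0 < a -> a < q ->
  exists n0, forall n, (n0 <= n)%N -> H * a ^+ n <= q ^+ n.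
Proof.
move=> H0 a0 aq; have q0 : 0 < q by exact: lt_trans aq.
have H1 : 0 < H + 1 by rewrite ltr_wpDl.
have : (a / q) ^+ n @[n --> \oo] --> (0 : R).
  by apply: cvg_expr; rewrite ger0_norm ?divr_ge0 ?ltW// ltr_pdivrMr// mul1r.
move=> /cvgrPdist_le/(_ (H + 1)^-1); rewrite invr_gt0 => /(_ H1) [n0 _ hn].
exists n0 => n /hn /=; rewrite sub0r normrN expr_div_n ger0_norm; last first.
  by rewrite divr_ge0// exprn_ge0// ltW.
rewrite ler_pdivrMr ?exprn_gt0// => h.
apply: (le_trans (ler_wpM2l H0 h)).
rewrite mulrA ler_piMl ?exprn_ge0 ?(ltW q0)//.
by rewrite ler_pdivrMr// mul1r lerDl.
Qed.

Lemma dist_in_itv (R : realDomainType) (a b u v : R) :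
  a <= u <= b -> a <= v <= b -> `|u - v| <= b - a.
Proof.
by move=> /andP[au ub] /andP[av vb]; rewrite ler_norml; apply/andP; split; lra.
Qed.

Lemma osc_near (R : realDomainType) (f V : R -> R) (M x0 r u v : R) :
  {homo V : x y / x <= y} ->
  (forall x y, - M <= x -> x <= y -> y <= M -> `|f x - f y| <= V y - V x) ->
  `|x0| + r <= M -> `|x0 - u| <= r -> `|x0 - v| <= r ->
  `|f u - f v| <= V (x0 + r) - V (x0 - r).
Proof.
move=> Vh fV x0M; wlog uv : u v / u <= v.
  move=> h hu hv; case: (leP u v) => [uv|/ltW vu]; first exact: h.
  by rewrite distrC; exact: h.
move=> hu hv.
have /andP[u1 u2] : x0 - r <= u <= x0 + r by rewrite -ler_distl distrC.
have /andP[v1 v2] : x0 - r <= v <= x0 + r by rewrite -ler_distl distrC.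
have [M1 M2] : - M <= x0 - r /\ x0 + r <= M.
  by move: (ler_norm x0) (ler_norm (- x0)); rewrite normrN; split; lra.
apply: (le_trans (fV _ _ (le_trans M1 u1) uv (le_trans v2 M2))).
by apply: lerB; exact: Vh.
Qed.

(** All the randomness that matters: almost every path of [f (Z t)] has cell
    oscillations that are summable with weights [c ^+ n].  The integer [M] bounds
    the path of [Z] and the level [n0] is the one from which its Hoelder bound is
    below [q ^+ n]; both are random, which is why the estimate of
    [ae_sampled_osc] is first taken for all integers [M] at once. *)
Lemma ae_path_osc d (Omega : measurableType d) (R : realType)
    (P : probability Omega R) (T alpha c q : R) (f : R -> R)
    (Z : R -> {RV P >-> R}) :
  0 < T -> 0 < alpha -> BV_loc f -> holder_process T alpha Z ->
  assumption_D T Z -> 0 < c -> 2 `^ (- alpha) < q -> q < 1 -> 2 * c * q < 1 ->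
  {ae P, forall w, exists (o : nat -> nat -> R) (n0 : nat) (S : R),
    [/\ forall n k, 0 <= o n k,
        forall n k s t, (n0 <= n)%N -> (k < 2 ^ n)%N ->
          grid T n k <= s <= grid T n k.+1 ->
          grid T n k <= t <= grid T n k.+1 ->
          `|f (Z s w) - f (Z t w)| <= o n k &
        forall m, \sum_(0 <= n < m) c ^+ n * \sum_(0 <= k < 2 ^ n) o n k <= S]}.
Proof.
move=> T0 alpha0 fBV ZH ZD c0 aq q1 cq1.
have a0 : 0 < 2 `^ (- alpha) :> R by rewrite powR_gt0.
have q0 : 0 < q by exact: lt_trans aq.
have [ts [G [D [tsin tsG D0 GD]]]] := sample_times T0 ZD.
pose VM (M : nat) := BV_loc_controlled fBV (ler0n R M).
pose V M := projT1 (cid (VM M)).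
pose B M := projT1 (cid (projT2 (cid (VM M)))).
have VMP M := projT2 (cid (projT2 (cid (VM M)))).
have aeS : {ae P, forall w, forall M : nat, exists S, forall m,
    \sum_(0 <= n < m) c ^+ n *
      \sum_(0 <= k < 2 ^ n) cell_osc (V M) M%:R (q ^+ n) (Z (ts n k) w) <= S}.
  apply: ae_foralln => M; have [Vh VB _] := VMP M.
  exact: (ae_sampled_osc tsG D0 GD Vh VB).
apply: filterS2 ZH aeS => w Zw Sw.
have [H H0 ZwH] := holder_on_dyadic T0 alpha0 Zw.
pose M := (Num.truncn (`|Z 0 w| + H + 1)).+1.
have ZM t : 0 <= t <= T -> `|Z t w| + 1 < M%:R.
  move=> t0T.
  apply: (@le_lt_trans _ _ (`|Z 0 w| + H + 1)); last exact: truncnS_gt.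
  rewrite lerD2r -lerBlDl; apply: (le_trans (lerB_dist _ _)).
  case/andP: (t0T) => t0 tT.
  rewrite -[leRHS]mulr1 -(expr0 (2 `^ (- alpha))); apply: ZwH => //.
    by rewrite lexx ltW.
  by rewrite subr0 expr0 divr1 ger0_norm.
have [S SM] := Sw M; have [Vh VB VMf] := VMP M.
have [n0 hn0] := geometric_dominated H0 a0 aq.
exists (fun n k => cell_osc (V M) M%:R (q ^+ n) (Z (ts n k) w)), n0, S.
split => //.
  by move=> n k; apply: cell_osc_ge0 => //; rewrite exprn_gt0.
move=> n k s t n0n kn sk tk.
have kin u : grid T n k <= u <= grid T n k.+1 -> 0 <= u <= T.
  have /andP[gk0 _] := grid_in T0 (ltnW kn).
  have /andP[_ gkT] := grid_in T0 kn.
  by move=> /andP[ku uk]; rewrite (le_trans gk0 ku) (le_trans uk gkT).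
have tsk := tsin n k kn.
have close u : grid T n k <= u <= grid T n k.+1 ->
    `|Z (ts n k) w - Z u w| <= q ^+ n.
  move=> uk; rewrite (le_trans _ (hn0 _ n0n))// ZwH ?kin//.
  by rewrite (le_trans (dist_in_itv tsk uk))// gridS addrC addKr.
have qn1 : q ^+ n <= 1 by rewrite exprn_ile1// ltW.
have tsM := ZM _ (kin _ tsk).
apply: (le_trans (osc_near Vh VMf _ (close _ sk) (close _ tk))).
  by rewrite (le_trans _ (ltW tsM))// lerD2l.
apply: cell_osc_ge => //; first exact: exprn_gt0.
by rewrite (le_lt_trans _ tsM)// lerDl.
Qed.

(** * Pathwise integrals and integration by parts *)

(** Division points may repeat here, unlike in [itv_partition], because tags
    become division points when summing by parts. *)
Definition RS_path (R : realType) (T : R) (x y : R -> R) (J : R) : Prop :=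
  forall e, 0 < e -> exists2 h, 0 < h & forall K p tau,
    p 0%N = 0 -> p K = T ->
    (forall i, (i < K)%N -> p i <= tau i <= p i.+1) ->
    (forall i, (i < K)%N -> p i.+1 - p i <= h) ->
    `|J - \sum_(0 <= i < K) x (tau i) * (y (p i.+1) - y (p i))| <= e.

(** Summation by parts: the new division points [p'] are the old tags, framed
    by [0] and [T], and the new tags are the old division points. *)
Lemma RS_path_parts (R : realType) (T : R) (x y : R -> R) (J : R) :
  0 < T ->
  RS_path T x y J -> RS_path T y x (y T * x T - y 0 * x 0 - J).
Proof.
move=> T0 xyJ e e0; have [h h0 hJ] := xyJ e e0.
exists (h / 2); first by rewrite divr_gt0.
move=> K p tau p0 pK ptau pmesh.
have K0 : (0 < K)%N.
  by case: K pK {ptau pmesh} => // pK; move: T0; rewrite -pK p0 ltxx.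
pose p' i := if i is j.+1 then (if (j < K)%N then tau j else T) else 0.
have := hJ K.+1 p' p erefl.
rewrite {1}/p' ltnn => /(_ erefl).
have ptau0 i (iK : (i < K)%N) : p i <= tau i by have /andP[] := ptau i iK.
have ptau1 i (iK : (i < K)%N) : tau i <= p i.+1 by have /andP[] := ptau i iK.
have tags' i : (i < K.+1)%N -> p' i <= p i <= p' i.+1.
  rewrite ltnS => iK; rewrite /p'; apply/andP; split.
    by case: i iK => [|i] iK; rewrite ?p0// iK ptau1.
  case: ltnP => iK'; first exact: ptau0.
  by rewrite -pK (_ : i = K)//; apply/eqP; rewrite eqn_leq iK.
move=> /(_ tags').
have mesh' i : (i < K.+1)%N -> p' i.+1 - p' i <= h.
  rewrite ltnS => iK; rewrite /p'.
  have pm j (jK : (j < K)%N) := pmesh _ jK.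
  case: i iK => [|i] iK.
    by rewrite K0; have := ptau1 _ K0; have := pm _ K0; rewrite p0; lra.
  rewrite iK; case: ltnP => iK'.
    have := pm _ iK; have := pm _ iK'; have := ptau0 _ iK.
    by have := ptau1 _ iK'; lra.
  have -> : T = p i.+1 by rewrite -pK; congr p; apply/eqP; rewrite eqn_leq iK' iK.
  by have := pm _ iK; have := ptau0 _ iK; lra.
move=> /(_ mesh').
suff -> : \sum_(0 <= i < K.+1) x (p i) * (y (p' i.+1) - y (p' i)) =
  y T * x T - y 0 * x 0 - \sum_(0 <= i < K) y (tau i) * (x (p i.+1) - x (p i)).
  rewrite distrC => hle; apply: le_trans hle; rewrite le_eqVlt.
  by apply/orP; left; apply/eqP; congr `| _ |; ring.
have -> : \sum_(0 <= i < K) y (tau i) * (x (p i.+1) - x (p i)) =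
   \sum_(0 <= i < K) y (p' i.+1) * (x (p i.+1) - x (p i)).
  by apply: eq_big_nat => i /andP[_ iK]; rewrite /p' iK.
have part L : \sum_(0 <= i < L.+1) x (p i) * (y (p' i.+1) - y (p' i)) =
   x (p L) * y (p' L.+1) - x (p 0%N) * y (p' 0%N) -
   \sum_(0 <= i < L) y (p' i.+1) * (x (p i.+1) - x (p i)).
  elim: L => [|L IH]; first by rewrite big_nat1 big_geq//; ring.
  by rewrite big_nat_recr//= IH [in RHS]big_nat_recr//=; ring.
by rewrite part pK p0 {1 2}/p' ltnn (mulrC (x T)) (mulrC (x 0)).
Qed.

Lemma RS_path_cvg (R : realType) (T : R) (x y : R -> R) (J : R)
    (s : nat -> seq R) (tau : nat -> nat -> R) :
  RS_path T x y J ->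
  (forall n, itv_partition 0 T (s n)) -> (forall n, tags (s n) (tau n)) ->
  mesh (s n) @[n --> \oo] --> (0 : R) ->
  RS_sum x y (s n) (tau n) @[n --> \oo] --> J.
Proof.
move=> xyJ sT stau smesh; apply/cvgrPdist_le => e e0.
have [h h0 hJ] := xyJ e e0.
move/cvgrPdist_le : smesh => /(_ h h0); apply: filterS => n.
rewrite sub0r normrN => sn; apply: hJ.
- by [].
- by rewrite /pt nth_last/=; case: (sT n) => _ /eqP.
- by move=> i iK; exact: stau.
- move=> i iK; apply: (le_trans _ sn); apply: (le_trans _ (ler_norm _)).
  apply: (le_trans (ler_norm _)); rewrite /mesh.
  rewrite big_mkord; exact: (le_bigmax _
    (fun i : 'I_(size (s n)) => `|pt (s n) i.+1 - pt (s n) i|) (Ordinal iK)).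
Qed.

(** The integral is the limit of the dyadic sums; taking the upper limit
    instead makes it a random variable defined everywhere. *)
Lemma ae_RS_path d (Omega : measurableType d) (R : realType)
    (P : probability Omega R) (T alpha gamma : R) (X Y : R -> {RV P >-> R}) :
  0 < T -> 0 < alpha -> 0 < gamma -> gamma <= 1 -> 1 < alpha + gamma ->
  BViC T alpha X -> holder_process T gamma Y ->
  exists I : {RV P >-> R}, {ae P, forall w,
    RS_path T (fun t => X t w) (fun t => Y t w) (I w)}.
Proof.
move=> T0 alpha0 gamma0 gamma1 ag [f [Z [fBV ZH ZD XZ]]] YH.
pose c : R := 2 `^ (- gamma).
(* Any exponent strictly between [1 - gamma] and [alpha] would do. *)
pose beta := (1 - gamma + alpha) / 2.
pose q : R := 2 `^ (- beta).
have c0 : 0 < c by rewrite powR_gt0.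
have c1 : c < 1 by rewrite -[ltRHS](powRr0 (2 : R)); apply: ltr_pow2; lra.
have aq : 2 `^ (- alpha) < q by apply: ltr_pow2; rewrite /beta; lra.
have q1 : q < 1.
  by rewrite -[ltRHS](powRr0 (2 : R)); apply: ltr_pow2; rewrite /beta; lra.
have cq1 : 2 * c * q < 1.
  rewrite /c /q -{1}(powRr1 (ler0n R 2)) -!powRD;
    try by rewrite pnatr_eq0 implybT.
  by rewrite -[ltRHS](powRr0 (2 : R)); apply: ltr_pow2; rewrite /beta; lra.
pose DS m w := dyadic_sum T (fun t => Y t w) (fun t => X t w) m.
have mDS m : measurable_fun setT (DS m).
  rewrite /DS /dyadic_sum; apply: measurable_sum => k.
  by apply: measurable_funM => //; exact: measurable_funB.
pose I0 w := fine (limn_esup (fun m => (DS m w)%:E)).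
have mI0 : measurable_fun setT I0.
  apply: measurableT_comp => //; apply: measurable_fun_limn_esup => m.
  exact/measurable_EFinP.
pose I1 : {mfun Omega >-> R} := HB.pack I0 (isMeasurableFun.Build _ _ _ _ I0 mI0).
exists I1.
apply: filterS2 YH (ae_path_osc T0 alpha0 fBV ZH ZD c0 aq q1 cq1) => w Yw.
move=> [ o [n0 [S [ o0 fo oS]]]].
have [H H0 YwH] := holder_on_dyadic T0 gamma0 Yw.
have Xfo n k s t : (n0 <= n)%N -> (k < 2 ^ n)%N ->
    grid T n k <= s <= grid T n k.+1 -> grid T n k <= t <= grid T n k.+1 ->
    `|X s w - X t w| <= o n k.
  move=> n0n kn sk tk.
  have kin u : grid T n k <= u <= grid T n k.+1 -> u \in `[0, T].
    have /andP[gk0 _] := grid_in T0 (ltnW kn).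
    have /andP[_ gkT] := grid_in T0 kn.
    by move=> /andP[ku uk]; rewrite in_itv/= (le_trans gk0 ku) (le_trans uk gkT).
  by rewrite !XZ ?kin//; exact: fo.
have Icvg := dyadic_sum_cvg T0 H0 c0 c1 YwH o0 Xfo oS.
have Ecvg : (DS m w)%:E @[m --> \oo] --> (limn (fun m => DS m w))%:E.
  by apply: cvg_EFin => //; exact: nearW.
have -> : I1 w = limn (fun m => DS m w).
  rewrite /I1/= /I0 is_cvg_limn_esupE; last first.
    by apply/cvg_ex; exists (limn (fun m => DS m w))%:E.
  by rewrite (cvg_lim _ Ecvg).
move=> e e0; have [N hN] := riemann_sums_cvg T0 H0 c0 c1 YwH o0 Xfo oS e0.
by exists (T / 2 ^+ N); [exact: mesh_gt0|exact: hN].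
Qed.
(** * The theorem *)

Unset Implicit Arguments.

Theorem theorem4p3 (d : measure_display) (Omega : measurableType d)
  (R : realType) (P : probability Omega R) (T alpha gamma : R)
  (T_gt0 : 0 < T)
  (alpha_gt0 : 0 < alpha) (alpha_le1 : alpha <= 1)
  (gamma_gt0 : 0 < gamma) (gamma_le1 : gamma <= 1)
  (alpha_gamma : 1 < alpha + gamma)
  (X Y : R -> {RV P >-> R})
  (hX : BViC T alpha X) (hY : holder_process T gamma Y) :
  exists IYX IXY : {RV P >-> R},
    [/\ is_RS_integral T Y X IYX, is_RS_integral T X Y IXY &
        {ae P, forall w,
          IXY w = Y T w * X T w - Y 0 w * X 0 w - IYX w}].
Proof.
have [I XY] := ae_RS_path T_gt0 alpha_gt0 gamma_gt0 gamma_le1 alpha_gamma hX hY.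
pose J0 w := Y T w * X T w - Y 0 w * X 0 w - I w.
have mJ0 : measurable_fun setT J0.
  apply: measurable_funB => //; apply: measurable_funB => //;
  exact: measurable_funM.
pose J : {mfun Omega >-> R} := HB.pack J0 (isMeasurableFun.Build _ _ _ _ J0 mJ0).
exists J, I; split.
- move=> s tau sT stau smesh; apply: filterS XY => w XYw.
  by apply: RS_path_cvg sT stau smesh; exact: RS_path_parts.
- move=> s tau sT stau smesh; apply: filterS XY => w XYw.
  exact: RS_path_cvg sT stau smesh.
- by apply: aeW => w; rewrite /J/= /J0 opprB addrC subrK.
Qed.
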